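(* Let $C$ and $D$ be a storage code and a retrieval code, respectively, for the private information retrieval scheme $\mathscr{S}$ described in the context; that is, $C$ is a linear $[n,k,d_C]$ code over $\mathbb{F}_{q^m}$ and $D$ is a linear code of length $n$ over $\mathbb{F}_{q^m}$. Let $D|_{\mathbb{F}_q}=D\cap\mathbb{F}_q^n$ be the subfield subcode of $D$. Then one can define a low complexity variant $\mathscr{S}|_{\mathbb{F}_q}$ of $\mathscr{S}$ by replacing the retrieval code $D$ with $D|_{\mathbb{F}_q}$. The scheme $\mathscr{S}|_{\mathbb{F}_q}$ has at least the same rate as the scheme $\mathscr{S}$, and it protects against $t'$-collusion, where $t'=d_{\mathrm{Tr}(D^\perp)}-1$.
   Context: Codes. For a linear code $E$, $d_E$ is its minimum Hamming distance. $D^\perp$ is the dual of $D$ in $\mathbb{F}_{q^m}^n$ with respect to the standard bilinear form. For a code $E\subseteq\mathbb{F}_{q^m}^n$, the trace code is $\mathrm{Tr}(E)=\{(\mathrm{Tr}(x_1),\dots,\mathrm{Tr}(x_n)) : x\in E\}\subseteq\mathbb{F}_q^n$, where $\mathrm{Tr}:\mathbb{F}_{q^m}\to\mathbb{F}_q$ is the field trace. The star product $C\star E$ is the span over $\mathbb{F}_{q^m}$ of all coordinatewise products of a codeword of $C$ and a codeword of $E$. Write $[r]=\{1,\dots,r\}$. The scheme with storage code $C$ and retrieval code $E$ (for $\mathscr{S}$, $E=D$; for $\mathscr{S}|_{\mathbb{F}_q}$, $E=D|_{\mathbb{F}_q}$). Put $c=d_{C\star E}-1$, $b=\mathrm{lcm}(c,k)/k$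 and $s=\mathrm{lcm}(c,k)/c$. There are $\mu$ files $x^1,\dots,x^\mu\in\mathbb{F}_{q^m}^{b\times k}$. They are stacked into a $\mu b\times k$ matrix $X$ and encoded as $Y=XG_C$, with $G_C$ a generator matrix of $C$; server $j\in[n]$ stores the $j$-th column $\boldsymbol{y}_j$ of $Y$. After perhaps a rearrangement of the servers, $J=\{1,\dots,\max\{k,c\}\}$ is the index set of servers from which symbols of the desired file are downloaded. To retrieve file $i$, the user chooses $\mu b$ codewords of $E$ uniformly at random and lets $\boldsymbol{d}_j$ be the vector, of length $\mu b$, of their $j$-th entries (ordered by file, then by row). For $a\in[b]$ put $J_1^a=\{(a-1)c/b+1,\dots,ac/b\}$ and $J_1=\bigcup_a J_1^a=[c]$. Server $j$ receives the query $\boldsymbol{q}_j=\boldsymbol{d}_j+\boldsymbol{e}_{b(i-1)+a}$ if $j\in J_1^a$, and $\boldsymbol{q}_j=\boldsymbol{d}_j$ if $j\notin J_1$, where $\boldsymbol{e}_r$ is the $r$-th standard basis vector. It responds with $r_j=\langle\boldsymbol{q}_j,\boldsymbol{y}_j\rangle\in\mathbb{F}_{q^m}$. This is iterated, for $s$ iterations in total, where in iteration $u$ the sets $J_1^a$ are replaced by sets $J_u^a$ obtained from $J_{u-1}^a$ by adding $c/b$ to every element modulo $|J|$ (a cyclic shift within $J$). In each iteration the user multiplies the response vector $(r_1,\dots,r_n)^T$ by a parity check matrix of $C\star E$ to recover $c$ encoded symbols of file $i$ (those in row $a$ at the servers $j\in J_u^a$); after $s$ iterations the file is reconstructed from these symbols.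 ''Low complexity'' refers to the computation of the responses $r_j$: with a retrieval code contained in $\mathbb{F}_q^n$, the queries have entries in $\mathbb{F}_q$ rather than $\mathbb{F}_{q^m}$. The rate of a scheme is the size of the retrieved file divided by the total amount of data downloaded from the servers. A scheme protects against $t$-collusion (protects against $t$ colluding servers) if the queries received jointly by any $t$ servers reveal nothing about the index $i$ of the desired file.
   Formalization: Recovery of the whole file is claimed only when, after rearranging servers, those read for each row form an information set of C (shown possible if c'≤k or some c' servers have all k-subsets as information sets); otherwise it can fail. k,c≥1 is assumed; codewords are fresh per iteration. *)

(* Defs.v *)
From HB Require Import structures.
From mathcomp Require Import all_boot all_order all_algebra all_fingroup.
From mathcomp Require Import all_field.

Set Implicit Arguments.
Unset Strict Implicit.
Unset Printing Implicit Defensive.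

Import Order.TTheory GRing.Theory Num.Theory.

Local Open Scope ring_scope.

(* ---------- Codes ---------- *)

(* Codes are sets of words.  The alphabet is the large field, and F_q is
   identified with its copy [1%VS] inside it; a code over F_q is a set of words
   with all entries in [1%VS]. *)

Definition hamming (K : finFieldType) (n : nat) (x y : 'rV[K]_n) : nat :=
  #|[set j | x 0 j != y 0 j]|.

(* A code with at most one codeword gets minimum distance n + 1, so that
   d - 1 = n: any n erasures can be corrected in the zero code. *)
Definition min_dist (K : finFieldType) (n : nat) (E : {set 'rV[K]_n}) : nat :=
  \big[Order.min/n.+1]_(p : 'rV[K]_n * 'rV[K]_n
                    | [&& p.1 \in E, p.2 \in E & p.1 != p.2]) hamming p.1 p.2.

Definition codewords (K : finFieldType) (n : nat) (V : {vspace 'rV[K]_n}) :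
  {set 'rV[K]_n} := [set x in V].

Definition dual_code (K : finFieldType) (n : nat) (V : {vspace 'rV[K]_n}) :
  {set 'rV[K]_n} := [set x | [forall y in V, x *m y^T == 0]].

Definition star (K : finFieldType) (n : nat) (C : {vspace 'rV[K]_n})
    (E : {set 'rV[K]_n}) : {vspace 'rV[K]_n} :=
  <<[seq map2_mx *%R x y | x <- enum C, y <- enum E]>>%VS.

Definition subfield_subcode (F : finFieldType) (L : fieldExtType F) (n : nat)
    (D : {vspace 'rV[finvect_type L]_n}) : {set 'rV[finvect_type L]_n} :=
  [set x in D | [forall j, x 0 j \in (1%VS : {vspace finvect_type L})]].

Definition trace (F : finFieldType) (L : fieldExtType F) (x : finvect_type L) :
  finvect_type L := galTrace 1%VS {: finvect_type L}%VS x.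

Definition trace_code (F : finFieldType) (L : fieldExtType F) (n : nat)
    (E : {set 'rV[finvect_type L]_n}) : {set 'rV[finvect_type L]_n} :=
  [set map_mx (@trace F L) x | x in E].

Definition generator_matrix (K : finFieldType) (n : nat)
    (C : {vspace 'rV[K]_n}) (G : 'M[K]_(\dim C, n)) : Prop :=
  basis_of C [seq row i G | i : 'I_(\dim C)].

Definition parity_check_matrix (K : finFieldType) (n : nat)
    (V : {vspace 'rV[K]_n}) (H : 'M[K]_(n - \dim V, n)) : Prop :=
  forall x : 'rV[K]_n, (x \in V) = (H *m x^T == 0).

Definition information_set (K : finFieldType) (n : nat)
    (C : {vspace 'rV[K]_n}) (I : {set 'I_n}) : Prop :=
  #|I| = \dim C /\
  forall x : 'rV[K]_n, x \in C -> (forall j, j \in I -> x 0 j = 0) -> x = 0.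

(* ---------- The scheme with storage code C and retrieval code E ---------- *)

Definition pir_c (K : finFieldType) (n : nat) (C : {vspace 'rV[K]_n})
    (E : {set 'rV[K]_n}) : nat :=
  (min_dist (codewords (star C E))).-1.

Definition pir_b (K : finFieldType) (n : nat) (C : {vspace 'rV[K]_n})
    (E : {set 'rV[K]_n}) : nat :=
  (lcmn (pir_c C E) (\dim C) %/ \dim C)%N.

Definition pir_s (K : finFieldType) (n : nat) (C : {vspace 'rV[K]_n})
    (E : {set 'rV[K]_n}) : nat :=
  (lcmn (pir_c C E) (\dim C) %/ pir_c C E)%N.

(* The divisors in the definitions of b and s are nonzero. *)
Definition pir_admissible (K : finFieldType) (n : nat)
    (C : {vspace 'rV[K]_n}) (E : {set 'rV[K]_n}) : bool :=
  (0 < \dim C)%N && (0 < pir_c C E)%N.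

(* Rows, iterations and server positions are numbered from 0: [pir_J C E u a]
   lists the positions in J_(u+1)^(a+1), where J = {0, .., max(k, c) - 1}. *)
Definition pir_J (K : finFieldType) (n : nat) (C : {vspace 'rV[K]_n})
    (E : {set 'rV[K]_n}) (u a : nat) : seq nat :=
  let g := (pir_c C E %/ pir_b C E)%N in
  iter u (map (fun p => (p + g) %% maxn (\dim C) (pir_c C E))%N)
    (iota (a * g) g).

(* The arrangement [rho] of the servers puts server [rho p] at position [p]. *)
Definition pir_servers (K : finFieldType) (n : nat) (C : {vspace 'rV[K]_n})
    (E : {set 'rV[K]_n}) (rho : 'S_n) (u a : nat) : {set 'I_n} :=
  [set rho p | p : 'I_n & (p : nat) \in pir_J C E u a].

(* Row a of the desired file is read off k servers over the s iterations; the
   file is determined by what is read if these servers form an information set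
   of C for every a. *)
Definition pir_arrangement (K : finFieldType) (n : nat)
    (C : {vspace 'rV[K]_n}) (E : {set 'rV[K]_n}) (rho : 'S_n) : Prop :=
  forall a : 'I_(pir_b C E),
    information_set C (\bigcup_(u < pir_s C E) pir_servers C E rho u a).

(* The codewords chosen by the user are fresh in every iteration u.  They are
   the rows of [d u], so that the vector d_j is [col j (d u)]. *)
Definition pir_random (K : finFieldType) (n : nat) (C : {vspace 'rV[K]_n})
    (E : {set 'rV[K]_n}) (mu : nat) :
    {set {ffun 'I_(pir_s C E) -> 'M[K]_(mu * pir_b C E, n)}} :=
  [set d : {ffun 'I_(pir_s C E) -> 'M[K]_(mu * pir_b C E, n)}
    | [forall u, forall r, row r (d u) \in E]].

(* At most one term of the sum is present, as the J_u^a are disjoint;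
   [mxvec_index i a] is row a of file i in the stacked matrix. *)
Definition pir_query (K : finFieldType) (n : nat) (C : {vspace 'rV[K]_n})
    (E : {set 'rV[K]_n}) (rho : 'S_n) (mu : nat) (i : 'I_mu)
    (d : {ffun 'I_(pir_s C E) -> 'M[K]_(mu * pir_b C E, n)})
    (u : 'I_(pir_s C E)) (j : 'I_n) : 'cV[K]_(mu * pir_b C E) :=
  col j (d u) +
  \sum_(a < pir_b C E | j \in pir_servers C E rho u a)
     delta_mx (mxvec_index i a) 0.

Definition pir_storage (K : finFieldType) (n : nat) (C : {vspace 'rV[K]_n})
    (G : 'M[K]_(\dim C, n)) (mu b : nat) (x : 'I_mu -> 'M[K]_(b, \dim C)) :
    'M[K]_(mu * b, n) :=
  (\matrix_(r < mu * b, l < \dim C)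
     mxvec (\matrix_(f < mu, a < b) x f a l) 0 r) *m G.

Definition pir_response (K : finFieldType) (n : nat) (C : {vspace 'rV[K]_n})
    (E : {set 'rV[K]_n}) (G : 'M[K]_(\dim C, n)) (rho : 'S_n) (mu : nat)
    (x : 'I_mu -> 'M[K]_(pir_b C E, \dim C)) (i : 'I_mu)
    (d : {ffun 'I_(pir_s C E) -> 'M[K]_(mu * pir_b C E, n)})
    (u : 'I_(pir_s C E)) : 'cV[K]_n :=
  \col_j ((pir_query rho i d u j)^T *m col j (pir_storage G x)) 0 0.

(* The decoders below are given only the products of the responses with a parity
   check matrix; they know neither the stored files nor the codewords d. *)

Definition pir_recovers_symbols (K : finFieldType) (n : nat)
    (C : {vspace 'rV[K]_n}) (E : {set 'rV[K]_n}) : Prop :=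
  forall (G : 'M[K]_(\dim C, n)) (H : 'M[K]_(n - \dim (star C E), n))
         (rho : 'S_n),
  generator_matrix G -> parity_check_matrix (V := star C E) H ->
  exists dec : 'I_(pir_s C E) -> 'cV[K]_(n - \dim (star C E)) ->
               'M[K]_(pir_b C E, n),
  forall (mu : nat) (x : 'I_mu -> 'M[K]_(pir_b C E, \dim C)) (i : 'I_mu) d,
  d \in pir_random C E mu ->
  forall (u : 'I_(pir_s C E)) (a : 'I_(pir_b C E)) (j : 'I_n),
  j \in pir_servers C E rho u a ->
  dec u (H *m pir_response G rho x i d u) a j =
  pir_storage G x (mxvec_index i a) j.

Definition pir_recovers_file (K : finFieldType) (n : nat)
    (C : {vspace 'rV[K]_n}) (E : {set 'rV[K]_n}) (rho : 'S_n) : Prop :=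
  forall (G : 'M[K]_(\dim C, n)) (H : 'M[K]_(n - \dim (star C E), n)),
  generator_matrix G -> parity_check_matrix (V := star C E) H ->
  exists dec : ('I_(pir_s C E) -> 'cV[K]_(n - \dim (star C E))) ->
               'M[K]_(pir_b C E, \dim C),
  forall (mu : nat) (x : 'I_mu -> 'M[K]_(pir_b C E, \dim C)) (i : 'I_mu) d,
  d \in pir_random C E mu ->
  dec (fun u => H *m pir_response G rho x i d u) = x i.

(* A file is a b x k matrix, and in each of the s iterations each of the n
   servers returns one element of the field. *)
Definition pir_rate (K : finFieldType) (n : nat) (C : {vspace 'rV[K]_n})
    (E : {set 'rV[K]_n}) : rat :=
  (pir_b C E * \dim C)%:R / (n * pir_s C E)%:R.

(* The probability that, when file i is requested, every server j in T receives
   the query [col j (v u)] in iteration u, for all u. *)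
Definition pir_query_prob (K : finFieldType) (n : nat)
    (C : {vspace 'rV[K]_n}) (E : {set 'rV[K]_n}) (rho : 'S_n) (mu : nat)
    (i : 'I_mu) (T : {set 'I_n})
    (v : 'I_(pir_s C E) -> 'M[K]_(mu * pir_b C E, n)) : rat :=
  #|[set d in pir_random C E mu
      | [forall u, forall j in T, pir_query rho i d u j == col j (v u)]]|%:R
  / #|pir_random C E mu|%:R.

Definition pir_protects (K : finFieldType) (n : nat)
    (C : {vspace 'rV[K]_n}) (E : {set 'rV[K]_n}) (t : nat) : Prop :=
  forall (rho : 'S_n) (mu : nat) (i i' : 'I_mu) (T : {set 'I_n})
         (v : 'I_(pir_s C E) -> 'M[K]_(mu * pir_b C E, n)),
  (#|T| <= t)%N -> pir_query_prob rho i T v = pir_query_prob rho i' T v.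

Definition pir_low_complexity (F : finFieldType) (L : fieldExtType F)
    (n : nat) (C : {vspace 'rV[finvect_type L]_n})
    (E : {set 'rV[finvect_type L]_n}) : Prop :=
  forall (rho : 'S_n) (mu : nat) (i : 'I_mu) d u j r,
  d \in pir_random C E mu ->
  pir_query rho i d u j r 0 \in (1%VS : {vspace finvect_type L}).

(* A sufficient condition for a suitable arrangement of the servers to exist. *)
Definition pir_arrangeable (K : finFieldType) (n : nat)
    (C : {vspace 'rV[K]_n}) (E : {set 'rV[K]_n}) : Prop :=
  (pir_c C E <= \dim C)%N \/
  exists S : {set 'I_n}, #|S| = pir_c C E /\
    forall I : {set 'I_n}, I \subset S -> #|I| = \dim C -> information_set C I.

(* Main.v *)
Require Import Defs.
From HB Require Import structures.
From mathcomp Require Import all_boot all_order all_algebra all_fingroup.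
From mathcomp Require Import all_field.

Set Implicit Arguments.
Unset Strict Implicit.
Unset Printing Implicit Defensive.

Import Order.TTheory GRing.Theory Num.Theory.

Local Open Scope ring_scope.

(* Replacing [D] by its subfield subcode shrinks [C * D], so the minimum distance
   of the star product, hence [c] and the rate c / n, can only grow.  Each
   response vector is a codeword of the star product plus an error supported on
   the [c] servers of one iteration, and a parity check matrix determines an error
   with known support of size [c = d - 1].  For the privacy, Delsarte's theorem
   identifies the dual over [F] of the subfield subcode with the trace code of the
   dual of [D]; any [t'] columns of the subfield subcode are therefore independent,
   and the shifts by unit vectors which reveal the file are absorbed into the
   random codewords. *)

(** * Minimum distance, star products, generator matrices and duals of codes *)

Section Codes.

Variables (K : finFieldType) (n : nat).
Implicit Types (x y : 'rV[K]_n) (C V : {vspace 'rV[K]_n}).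
Implicit Types (E : {set 'rV[K]_n}) (I S T : {set 'I_n}).

Lemma min_dist_le E x y :
  x \in E -> y \in E -> x != y -> (min_dist E <= hamming x y)%N.
Proof.
move=> xE yE neq_xy; rewrite -leEnat.
by apply: (@bigmin_le_cond _ _ _ _ (x, y)); rewrite xE yE.
Qed.

Lemma min_dist_leS E : (min_dist E <= n.+1)%N.
Proof. by rewrite -leEnat; apply: bigmin_le_id. Qed.

Lemma min_dist_gt0 E : (0 < min_dist E)%N.
Proof.
rewrite -leEnat; apply: le_bigmin => //= -[x y] /and3P[_ _ neq_xy]; rewrite leEnat.
rewrite card_gt0; apply: contraNneq neq_xy => /setP eq_xy.
apply/eqP; apply/rowP => j.
by have:= eq_xy j; rewrite !inE => /negbFE/eqP.
Qed.

Lemma min_distS E1 E2 : E1 \subset E2 -> (min_dist E2 <= min_dist E1)%N.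
Proof.
move=> /subsetP sE; rewrite -leEnat; apply: sub_bigmin => p /and3P[/sE-> /sE-> ->].
by [].
Qed.

(** Such an [x] is at distance at most [#|T|] from 0. This gives both the uniqueness of an error
    with known support and the injectivity of deleting the columns in [T]. *)
Lemma zero_of_small_support E T x :
    0 \in E -> x \in E -> (#|T| < min_dist E)%N ->
  (forall j, j \notin T -> x 0 j = 0) -> x = 0.
Proof.
move=> E0 xE ltT x0; apply: contraTeq ltT => nz_x.
rewrite -leqNgt (leq_trans (min_dist_le xE E0 nz_x)) // subset_leq_card //.
apply/subsetP=> j; rewrite inE mxE; apply: contraNT => /x0 ->.
exact: eqxx.
Qed.

Lemma starS C E1 E2 : E1 \subset E2 -> (star C E1 <= star C E2)%VS.
Proof.
move=> /subsetP sE; apply: sub_span => z /allpairsP[[x y] /= [xC yE ->]].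
apply/allpairsP; exists (x, y); split=> [||//]; first exact: xC.
by move: yE; rewrite !mem_enum; apply: sE.
Qed.

Lemma mem_star C E x y :
  x \in C -> y \in E -> map2_mx *%R x y \in star C E.
Proof. move=> xC yE; apply/memv_span/allpairsP.
by exists (x, y); split=> [||//]; rewrite mem_enum. Qed.

Lemma mem_generator_matrix C (G : 'M[K]_(\dim C, n)) :
  generator_matrix G -> forall x, (x \in C) = (x <= G)%MS.
Proof.
move=> /span_basis genG x; apply/idP/idP => [|/submxP[u ->]].
  rewrite -{1}genG => /(coord_span (X := in_tuple _)) ->.
  apply: summx_sub => i _; apply: scalemx_sub; case/mapP: (mem_nth 0 (ltn_ord i)).
  by move=> k _ ->; apply: row_sub.
rewrite mulmx_sum_row memv_suml // => i _; rewrite memvZ // -{2}genG memv_span //.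
by apply: map_f; rewrite mem_enum.
Qed.

Lemma generator_matrix_free C (G : 'M[K]_(\dim C, n)) :
  generator_matrix G -> row_free G.
Proof.
move=> /basis_free freeG; apply: inj_row_free => u; rewrite mulmx_sum_row => uG0.
have/freeP := (freeG : free [tuple row i G | i < \dim C]).
move=> /(_ (u 0)) u0; apply/rowP => i; rewrite mxE; apply: u0.
by rewrite -[RHS]uG0; apply: eq_bigr => j _; rewrite nth_mktuple.
Qed.

Lemma exists_generator_matrix C : {G : 'M[K]_(\dim C, n) | generator_matrix G}.
Proof.
exists (\matrix_i (vbasis C)`_i); rewrite /generator_matrix.
have -> // : [seq row i (\matrix_i (vbasis C)`_i) | i : 'I_(\dim C)] = vbasis C.
  rewrite -[RHS](mkseq_nth 0) size_tuple /mkseq -val_enum_ord -map_comp.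
  by apply: eq_map => i; rewrite /= rowK.
exact: vbasisP.
Qed.

(** A generator matrix has [\dim C] independent columns, and a codeword [u *m G] vanishing there
    forces [u = 0]. *)
Lemma exists_information_set C : exists I, information_set C I.
Proof.
have [G genG] := exists_generator_matrix C.
have fullG : row_full G^T.
  by rewrite /row_full mxrank_tr; apply: generator_matrix_free.
pose f := fullrankfun fullG; exists [set f i | i in 'I_(\dim C)]; split.
  by rewrite card_imset ?card_ord //; apply: fullrankfun_inj.
move=> x; rewrite (mem_generator_matrix genG) => /submxP[u ->] uG0.
have /row_fullP[B BG] := fullrowsub_full fullG.
suffices -> : u = 0 by rewrite mul0mx.
apply: trmx_inj; rewrite -[u^T]mul1mx -BG -mulmxA trmx0.
suffices -> : rowsub (fullrankfun fullG) G^T *m u^T = 0 by rewrite mulmx0.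
apply/colP => i; have := uG0 (f i) (imset_f f (isT : i \in 'I_(\dim C))).
by rewrite !mxE => uGi; rewrite -[RHS]uGi; apply: eq_bigr => k _; rewrite !mxE mulrC.
Qed.

(** The columns of the cokernel of a generator matrix lie in the dual, and orthogonality to all of
    them already characterizes the row space. *)
Lemma dual_codeK C x :
  (forall y, y \in dual_code C -> x *m y^T = 0) -> x \in C.
Proof.
move=> x_dual; have [G genG] := exists_generator_matrix C.
rewrite (mem_generator_matrix genG) submxE; apply/eqP; apply/rowP => l.
have /x_dual/matrixP/(_ 0 0) : (col l (cokermx G))^T \in dual_code C.
  rewrite inE; apply/forall_inP => z; rewrite (mem_generator_matrix genG) submxE.
  move=> /eqP zG; rewrite -trmx_mul -trmx0 (inj_eq trmx_inj) colE mulmxA zG.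
  by rewrite mul0mx.
by rewrite trmxK colE mulmxA -colE !mxE.
Qed.

Lemma dual_code0 C : 0 \in dual_code C.
Proof. by rewrite inE; apply/forall_inP => y _; rewrite mul0mx. Qed.

Lemma dual_codeD C x y :
  x \in dual_code C -> y \in dual_code C -> x + y \in dual_code C.
Proof.
rewrite !inE => /forall_inP x_dual /forall_inP y_dual; apply/forall_inP => z zC.
by rewrite mulmxDl (eqP (x_dual z zC)) (eqP (y_dual z zC)) addr0.
Qed.

Lemma dual_codeZ C a x : x \in dual_code C -> a *: x \in dual_code C.
Proof.
rewrite !inE => /forall_inP x_dual; apply/forall_inP => z zC.
by rewrite -scalemxAl (eqP (x_dual z zC)) scaler0.
Qed.

End Codes.

(* Deleting the columns in [T] is injective on the row space of [B], hence a
   right inverse of the remaining columns of a row basis solves for the entries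
   outside [T]. *)
Lemma interpolate_kernel (F : fieldType) (m n : nat) (B : 'M[F]_(m, n))
    (T : {set 'I_n}) (e : 'rV[F]_n) :
    (forall w : 'rV[F]_n, (w <= B)%MS ->
      (forall j, j \notin T -> w 0 j = 0) -> w = 0) ->
  exists2 x : 'rV[F]_n, x *m B^T = 0 & forall j, j \in T -> x 0 j = e 0 j.
Proof.
move=> B_inj; pose M := row_base B.
pose P := \matrix_(i, j) (if j \in T then 0 else M i j).
have freeP : row_free P.
  apply: inj_row_free => u uP0; have /row_free_inj := row_base_free B.
  move=> /(_ _) injM; apply: (injM 1%N); rewrite mul0mx; apply: B_inj.
    by rewrite (submx_trans (submxMl _ _)) ?eq_row_base.
  move=> j jT; have /rowP/(_ j) := uP0; rewrite !mxE => uPj; rewrite -[RHS]uPj.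
  by apply: eq_bigr => i _; rewrite [P _ _]mxE (negPf jT).
have [N PN] := row_freeP freeP.
pose eT : 'rV[F]_n := \row_j (if j \in T then e 0 j else 0).
pose z := - (eT *m M^T) *m N^T.
exists (\row_j (if j \in T then e 0 j else z 0 j)) => [|j jT].
  2: by rewrite mxE jT.
have zP : z *m P^T = - (eT *m M^T) by rewrite -mulmxA -trmx_mul PN trmx1 mulmx1.
set x := \row_j _; have xM : x *m M^T = 0.
  have -> : x *m M^T = eT *m M^T + z *m P^T.
    apply/rowP => i; rewrite !mxE -big_split; apply: eq_bigr => j _.
    rewrite ![_^T _ _]mxE [x _ _]mxE [eT _ _]mxE [P _ _]mxE.
    by case: ifP => _ /=; rewrite ?mulr0 ?addr0 ?mul0r ?add0r.
  by rewrite zP subrr.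
have /submxP[A ->] : (B <= M)%MS by rewrite eq_row_base.
by rewrite trmx_mul mulmxA xM mul0mx.
Qed.

(** * Server positions under the cyclic shift *)

(** Cut the [N * g] positions into [N] blocks of length [g]: a shift by [g] advances the block
    number modulo [N] and keeps the offset within the block. *)
Lemma iter_shift_block (N g u a : nat) : (a < N)%N ->
  iter u (map (fun p => (p + g) %% (N * g)))%N (iota (a * g) g) =
  [seq (a + u) %% N * g + r | r <- iota 0 g]%N.
Proof.
move=> ltaN; elim: u => [|u IHu]; first by rewrite addn0 modn_small // -iotaDl addn0.
rewrite iterS IHu -map_comp; apply/eq_in_map => r; rewrite mem_iota /= => ltrg.
rewrite addnAC -mulSnr addnS -[in RHS]addn1 -[in RHS]modnDml addn1.
set t := ((a + u) %% N)%N; have ltN0 : (0 < N)%N by apply: leq_ltn_trans ltaN.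
have ltg0 : (0 < g)%N by apply: leq_ltn_trans ltrg.
(* Either block [t] is the last one and wraps around to block 0, or its successor still starts below
   [N * g]. *)
have := ltn_pmod (a + u) ltN0; rewrite -/t leq_eqVlt => /predU1P[-> | lttN].
  by rewrite modnn modnDl modn_small // (leq_trans ltrg) // leq_pmull.
rewrite [(t.+1 %% N)%N]modn_small // modn_small //.
rewrite (leq_trans _ (leq_mul lttN (leqnn g))) //.
by rewrite [X in (_ < X)%N]mulSnr ltn_add2l.
Qed.

Section ServerPositions.

Variables (K : finFieldType) (n : nat) (C : {vspace 'rV[K]_n}).
Variables (E : {set 'rV[K]_n}).
Hypothesis adm : pir_admissible C E.

Let k_gt0 : (0 < \dim C)%N. Proof. by case/andP: adm. Qed.
Let c_gt0 : (0 < pir_c C E)%N. Proof. by case/andP: adm. Qed.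

(** In fact g = gcd(c, k), so c = b g and k = s g, and J consists of [N] blocks of length [g]. In
    iteration [u], row [a] is read from block (a + u) mod N. *)
Let g := (pir_c C E %/ pir_b C E)%N.
Let N := maxn (pir_s C E) (pir_b C E).

Let b_gcd : (pir_b C E * gcdn (pir_c C E) (\dim C) = pir_c C E)%N.
Proof.
apply/eqP; rewrite -(eqn_pmul2r k_gt0) mulnAC divnK ?dvdn_lcmr //.
by rewrite muln_lcm_gcd.
Qed.

Let s_gcd : (pir_s C E * gcdn (pir_c C E) (\dim C) = \dim C)%N.
Proof.
apply/eqP; rewrite -(eqn_pmul2r c_gt0) mulnAC divnK ?dvdn_lcml //.
by rewrite muln_lcm_gcd mulnC.
Qed.

Lemma pir_b_gt0 : (0 < pir_b C E)%N.
Proof. by move: c_gt0; rewrite -b_gcd muln_gt0 => /andP[]. Qed.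

Let gE : g = gcdn (pir_c C E) (\dim C).
Proof. by rewrite /g -{1}b_gcd mulKn // pir_b_gt0. Qed.

Let g_gt0 : (0 < g)%N. Proof. by rewrite gE gcdn_gt0 c_gt0. Qed.

Let N_gt0 : (0 < N)%N. Proof. by rewrite leq_max pir_b_gt0 orbT. Qed.

Let JE : maxn (\dim C) (pir_c C E) = (N * g)%N.
Proof. by rewrite maxnMl gE s_gcd b_gcd. Qed.

Lemma pir_c_le : (pir_c C E <= n)%N.
Proof. by rewrite /pir_c -ltnS prednK ?min_dist_gt0 ?min_dist_leS. Qed.

Lemma pir_J_le : (maxn (\dim C) (pir_c C E) <= n)%N.
Proof.
rewrite geq_max pir_c_le andbT (leq_trans (dimvS (subvf C))) //.
by rewrite dimvf /dim /= mul1n.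
Qed.

Let mem_J u a p : (a < pir_b C E)%N ->
  (p \in pir_J C E u a) = (p %/ g == (a + u) %% N)%N.
Proof.
move=> ltab; rewrite /pir_J -/g JE iter_shift_block; last first.
  by rewrite (leq_trans ltab) // leq_maxr.
apply/mapP/eqP => [[r] | <-].
  by rewrite mem_iota /= => ltrg ->; rewrite divnMDl // divn_small // addn0.
by exists (p %% g)%N; rewrite -?divn_eq // mem_iota ltn_pmod.
Qed.

Variable rho : 'S_n.

Let mem_servers u a p : (a < pir_b C E)%N ->
  (rho p \in pir_servers C E rho u a) = (p %/ g == (a + u) %% N)%N.
Proof. by move=> ltab; rewrite mem_imset ?inE ?mem_J //; apply: perm_inj. Qed.

(** Since b <= N, distinct rows have distinct block numbers modulo [N]; for distinct iterations, s
    <= N does the same. *)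
Lemma pir_servers_disjointl u a a' :
    (a < pir_b C E)%N -> (a' < pir_b C E)%N -> a != a' ->
  [disjoint pir_servers C E rho u a & pir_servers C E rho u a'].
Proof.
move=> ltab lta'b; apply: contraR => /pred0Pn[j /= /andP[]].
rewrite -[j](permKV rho) !mem_servers // => /eqP->.
by rewrite eqn_modDr !modn_small // (leq_trans _ (leq_maxr _ _)).
Qed.

Lemma pir_servers_disjointr u u' a :
    (u < pir_s C E)%N -> (u' < pir_s C E)%N -> (a < pir_b C E)%N -> u != u' ->
  [disjoint pir_servers C E rho u a & pir_servers C E rho u' a].
Proof.
move=> ltus ltu's ltab; apply: contraR => /pred0Pn[j /= /andP[]].
rewrite -[j](permKV rho) !mem_servers // => /eqP->.
by rewrite eqn_modDl !modn_small // (leq_trans _ (leq_maxl _ _)).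
Qed.

Lemma card_pir_servers u a : (a < pir_b C E)%N -> #|pir_servers C E rho u a| = g.
Proof.
move=> ltab; pose t := ((a + u) %% N)%N.
have lt_pos (r : 'I_g) : (t * g + r < n)%N.
  apply: leq_trans pir_J_le; rewrite JE.
  rewrite (leq_trans _ (leq_mul (ltn_pmod (a + u) N_gt0) (leqnn g))) // mulSnr.
  by rewrite ltn_add2l.
pose f r := rho (Ordinal (lt_pos r)).
have inj_f : injective f by move=> r r' /perm_inj/(congr1 val)/addnI/val_inj.
rewrite -[RHS]card_ord -(card_imset _ inj_f); apply: eq_card => j.
rewrite -[j](permKV rho) mem_servers //; set p := _ j.
apply/eqP/imsetP => [pt | [r _ /perm_inj->]]; last first.
  by rewrite /= divnMDl // divn_small // addn0.
exists (Ordinal (ltn_pmod p g_gt0)) => //; congr (rho _); apply: val_inj => /=.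
by rewrite {1}(divn_eq p g) pt.
Qed.

Lemma card_pir_servers_rows u :
  #|\bigcup_(a < pir_b C E) pir_servers C E rho u a| = pir_c C E.
Proof.
rewrite -sum1_card partition_disjoint_bigcup => [|a a' neq_a]; last first.
  by apply: pir_servers_disjointl.
under eq_bigr => a _ do rewrite sum1_card card_pir_servers //.
by rewrite sum_nat_const card_ord gE b_gcd.
Qed.

Lemma card_pir_servers_iterations a : (a < pir_b C E)%N ->
  #|\bigcup_(u < pir_s C E) pir_servers C E rho u a| = \dim C.
Proof.
move=> ltab; rewrite -sum1_card.
rewrite partition_disjoint_bigcup => [|u u' neq_u]; last first.
  by apply: pir_servers_disjointr.
under eq_bigr => u _ do rewrite sum1_card card_pir_servers //.
by rewrite sum_nat_const card_ord gE s_gcd.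
Qed.

Lemma pir_servers_position u a p : (a < pir_b C E)%N ->
  rho p \in pir_servers C E rho u a -> (p < maxn (\dim C) (pir_c C E))%N.
Proof.
move=> ltab; rewrite mem_servers // JE => /eqP p_div.
by rewrite -ltn_divLR // p_div ltn_pmod.
Qed.

End ServerPositions.

Lemma perm_initial_segment (n : nat) (S : {set 'I_n}) :
  {rho : 'S_n | forall p : 'I_n, (p < #|S|)%N -> rho p \in S}.
Proof.
pose s := enum S ++ enum (~: S).
have size_s : size s = n by rewrite size_cat -!cardE cardsC card_ord.
have uniq_s : uniq s.
  rewrite cat_uniq !enum_uniq andbT; apply/hasPn => j; rewrite !mem_enum inE.
  by [].
pose f p := tnth (Tuple (introT eqP size_s)) p.
have inj_f : injective f.
  by move=> p q; rewrite /f !(tnth_nth p) => /uniqP/val_inj; apply;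
    rewrite ?inE ?size_s.
exists (perm inj_f) => p ltpS; rewrite permE /f (tnth_nth p) /= nth_cat -cardE ltpS.
by rewrite -mem_enum mem_nth // -cardE.
Qed.

Lemma exists_pir_arrangement (K : finFieldType) (n : nat)
    (C : {vspace 'rV[K]_n}) (E : {set 'rV[K]_n}) :
    pir_admissible C E -> pir_arrangeable C E ->
  exists rho : 'S_n, pir_arrangement C E rho.
Proof.
move=> adm arr.
have [S [cardS infoS]] : exists S : {set 'I_n},
    #|S| = maxn (\dim C) (pir_c C E) /\
    forall I : {set 'I_n}, I \subset S -> #|I| = \dim C -> information_set C I.
  (* If c <= k, then J has k positions and any information set can be placed there: its only subset
     of size k is itself. If c > k, the set comes from [arr]. *)
  have [le_ck | lt_kc] := leqP (pir_c C E) (\dim C).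
    have [S infoS] := exists_information_set C; exists S; split.
      by case: infoS.
    move=> I sIS cardI; suffices -> : I = S by [].
    by apply/eqP; case: infoS => cardS _; rewrite eqEcard sIS cardI cardS leqnn.
  case: arr => [|[S [cardS infoS]]]; first by case: ltnP lt_kc.
  by exists S.
have [rho rhoS] := perm_initial_segment S; exists rho => a; apply: infoS.
  apply/bigcupsP => u _; apply/subsetP => j; rewrite -[j](permKV rho) => j_serv.
  by apply: rhoS; rewrite cardS (pir_servers_position adm _ j_serv).
exact: card_pir_servers_iterations.
Qed.

Lemma pir_rateE (K : finFieldType) (n : nat) (C : {vspace 'rV[K]_n})
    (E : {set 'rV[K]_n}) :
  pir_admissible C E -> pir_rate C E = (pir_c C E)%:R / n%:R.
Proof.
case/andP=> k_gt0 c_gt0; rewrite /pir_rate.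
have s_gt0 : (0 < pir_s C E)%N.
  by rewrite divn_gt0 // dvdn_leq ?dvdn_lcml ?lcmn_gt0 ?c_gt0.
(* Both b k and s c equal lcm(c, k), so s cancels. *)
rewrite divnK ?dvdn_lcmr // -[lcmn _ _](divnK (dvdn_lcml (pir_c C E) (\dim C))).
by rewrite mulnC !natrM -mulf_div divff ?mulr1 // pnatr_eq0 -lt0n.
Qed.

(** * Decoding of the responses and privacy of the queries *)

Section Retrieval.

Variables (K : finFieldType) (n : nat) (C : {vspace 'rV[K]_n}).
Variables (E : {set 'rV[K]_n}).

Lemma pir_storageE (G : 'M[K]_(\dim C, n)) mu b
    (x : 'I_mu -> 'M[K]_(b, \dim C)) i a j :
  pir_storage G x (mxvec_index i a) j = (x i *m G) a j.
Proof.
by rewrite /pir_storage !mxE; apply: eq_bigr => l _; rewrite !mxE mxvecE mxE.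
Qed.

Lemma row_pir_storage (G : 'M[K]_(\dim C, n)) mu b
    (x : 'I_mu -> 'M[K]_(b, \dim C)) r :
  generator_matrix G -> row r (pir_storage G x) \in C.
Proof.
by move=> genG; rewrite (mem_generator_matrix genG) row_mul submxMl.
Qed.

(** The contribution of the unit vectors in the queries: the desired symbols at the servers of
    iteration [u], and zero elsewhere. *)
Definition pir_error (G : 'M[K]_(\dim C, n)) (rho : 'S_n) mu
    (x : 'I_mu -> 'M[K]_(pir_b C E, \dim C)) i (u : 'I_(pir_s C E)) : 'rV[K]_n :=
  \row_j \sum_(a < pir_b C E | j \in pir_servers C E rho u a)
     pir_storage G x (mxvec_index i a) j.

(* The parity check removes the inner products with the random part of the
   queries, which form a codeword of the star product. *)
Lemma pir_syndrome (G : 'M[K]_(\dim C, n)) (H : 'M[K]_(n - \dim (star C E), n))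
    (rho : 'S_n) mu (x : 'I_mu -> 'M[K]_(pir_b C E, \dim C)) i d u :
    generator_matrix G -> parity_check_matrix (V := star C E) H ->
    d \in pir_random C E mu ->
  H *m pir_response G rho x i d u = H *m (pir_error G rho x i u)^T.
Proof.
move=> genG parH; rewrite inE => /forallP/(_ u)/forallP dE.
pose z := \sum_r map2_mx *%R (row r (pir_storage G x)) (row r (d u)).
have zE : z \in star C E.
  by apply: memv_suml => r _; apply: mem_star; rewrite ?row_pir_storage.
have -> : pir_response G rho x i d u = z^T + (pir_error G rho x i u)^T.
  apply/colP => j; rewrite [LHS]mxE [RHS]mxE ![_^T _ _]mxE summxE.
  rewrite /pir_query linearD mulmxDl [LHS]mxE; congr (_ + _).
    by rewrite mxE; apply: eq_bigr => r _; rewrite !mxE mulrC.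
  rewrite [RHS]mxE linear_sum mulmx_suml summxE; apply: eq_bigr => a _.
  by rewrite /= trmx_delta -rowE !mxE.
rewrite mulmxDr; have := zE; rewrite parH => /eqP->.
by rewrite add0r.
Qed.

Lemma pir_errorE G rho mu (x : 'I_mu -> 'M[K]_(pir_b C E, \dim C)) i
    (u : 'I_(pir_s C E)) (a : 'I_(pir_b C E)) j :
    pir_admissible C E -> j \in pir_servers C E rho u a ->
  pir_error G rho x i u 0 j = pir_storage G x (mxvec_index i a) j.
Proof.
move=> adm ja; rewrite mxE (big_pred1 a) // => a'; apply/idP/eqP => [ja' | -> //].
apply: contraTeq ja' => neq_a.
have := pir_servers_disjointl adm rho u (ltn_ord a') (ltn_ord a) neq_a.
by move/disjointFl->.
Qed.

Lemma pir_scheme_recovers_symbols : pir_admissible C E -> pir_recovers_symbols C E.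
Proof.
move=> adm G H rho genG parH.
pose T (u : 'I_(pir_s C E)) := \bigcup_(a < pir_b C E) pir_servers C E rho u a.
pose candidate u h := [pick e : 'rV[K]_n |
  (H *m e^T == h) && [forall j, (j \notin T u) ==> (e 0 j == 0)]].
exists (fun u h => \matrix_(a, j) odflt 0 (candidate u h) 0 j).
move=> mu x i d dE u a j ja; rewrite mxE -(pir_errorE G x i adm ja).
rewrite (pir_syndrome rho x i u genG parH dE) /candidate.
set e := pir_error _ _ _ _ _; have e0 l : l \notin T u -> e 0 l = 0.
  move=> lT; rewrite mxE big1 // => a' la'; case/negP: lT.
  by apply/bigcupP; exists a'.
case: pickP => [e' /andP[/eqP eqH /forall_inP e'0] | /(_ e)/negP[]]; last first.
  by rewrite eqxx; apply/forall_inP => l lT; apply/eqP; apply: e0.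
(* Two candidates differ by a codeword of the star product supported on c = d - 1 servers. *)
suffices /subr0_eq -> : e' - e = 0 by [].
apply: (@zero_of_small_support _ _ (codewords (star C E)) (T u));
  rewrite ?inE ?mem0v //.
- by rewrite parH linearB mulmxBr eqH subrr.
- by rewrite card_pir_servers_rows // prednK // min_dist_gt0.
- by move=> l lT; rewrite [LHS]mxE (eqP (e'0 l lT)) add0r mxE e0 // oppr0.
Qed.

(** The decoder picks any file consistent with all recovered symbols. It is unique: in each row, the
    encodings of two such files differ by a codeword vanishing on an information set. *)
Lemma pir_scheme_recovers_file (rho : 'S_n) :
  pir_admissible C E -> pir_arrangement C E rho -> pir_recovers_file C E rho.
Proof.
move=> adm arr G H genG parH.
have [dec decP] := pir_scheme_recovers_symbols adm rho genG parH.
pose consistent w (M : 'M[K]_(pir_b C E, \dim C)) :=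
  [forall u : 'I_(pir_s C E), forall a : 'I_(pir_b C E),
   forall j in pir_servers C E rho u a, (M *m G) a j == dec u (w u) a j].
exists (fun w => odflt 0 [pick M | consistent w M]) => mu x i d dE.
pose w u := H *m pir_response G rho x i d u; rewrite -/w.
have x_w : consistent w (x i).
  apply/'forall_'forall_forall_inP => u a j ja.
  by rewrite (decP _ x i d dE u a j ja) pir_storageE.
case: pickP => [M M_w | /(_ (x i))]; last by rewrite x_w.
apply: (row_free_inj (generator_matrix_free genG)); apply/row_matrixP => a.
apply: subr0_eq; case: (arr a) => _; apply=> [|j /bigcupP[u _ ja]].
  by rewrite (mem_generator_matrix genG) !row_mul -mulmxBl submxMl.
move/'forall_'forall_forall_inP/(_ u a j ja)/eqP: M_w => M_w.
move/'forall_'forall_forall_inP/(_ u a j ja)/eqP: x_w => x_w.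
by rewrite !mxE in M_w x_w *; rewrite M_w x_w subrr.
Qed.

(* Adding to the random codewords a fixed array of codewords which interpolates
   the difference of the two shifts on [T] turns the queries for file [i] into
   the same queries for file [i']. *)
Lemma pir_protects_interpolation t :
    {in E &, forall x y, x + y \in E} ->
    (forall (T : {set 'I_n}) (e : 'rV[int]_n), (#|T| <= t)%N ->
       exists2 x, x \in E & forall j, j \in T -> x 0 j = (e 0 j)%:~R) ->
  pir_protects C E t.
Proof.
move=> addE interpE rho mu i i' T v leTt.
suffices le_card i1 i2 :
    (#|[set d in pir_random C E mu |
          [forall u, forall j in T, pir_query rho i1 d u j == col j (v u)]]| <=
     #|[set d in pir_random C E mu |
          [forall u, forall j in T, pir_query rho i2 d u j == col j (v u)]]|)%N.
  by congr (_%:R / _); apply/eqP; rewrite eqn_leq !le_card.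
(* The shifts are counted in natural numbers so that their differences are integers, which can be
   interpreted in the subfield as well as in [K]. *)
pose N (i0 : 'I_mu) (u : 'I_(pir_s C E)) r j :=
  (\sum_(a < pir_b C E | j \in pir_servers C E rho u a) (r == mxvec_index i0 a))%N.
have queryE i0 d (u : 'I_(pir_s C E)) j r :
    pir_query rho i0 d u j r 0 = d u r j + (N i0 u r j)%:R.
  rewrite !mxE summxE natr_sum; congr (_ + _); apply: eq_bigr => a _.
  by rewrite mxE andbT.
have /fin_all_exists2[x xE xT] (p : 'I_(pir_s C E) * 'I_(mu * pir_b C E)) :=
  interpE T (\row_j ((N i1 p.1 p.2 j)%:Z - (N i2 p.1 p.2 j)%:Z)) leTt.
pose f (d : {ffun 'I_(pir_s C E) -> 'M[K]_(mu * pir_b C E, n)}) :=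
  [ffun u => d u + \matrix_r x (u, r)].
have inj_f : injective f.
  move=> d d' /ffunP eq_d; apply/ffunP => u; have := eq_d u.
  by rewrite !ffunE => /addIr.
rewrite -(card_imset _ inj_f) subset_leq_card //; apply/subsetP => _ /imsetP[d + ->].
rewrite !inE => /andP[/'forall_forallP dE /'forall_forall_inP dv]; apply/andP; split.
  apply/'forall_forallP => u r; have <- : row r (d u) + x (u, r) = row r (f d u).
    by apply/rowP => j; rewrite ffunE !mxE.
  exact: addE.
apply/'forall_forall_inP => u j jT; rewrite -(eqP (dv u j jT)).
apply/eqP/colP => r; rewrite !queryE ffunE 2!mxE xT // mxE rmorphB /= -!pmulrn.
by rewrite -addrA subrK.
Qed.

End Retrieval.

(** * The trace form and subfield subcodes *)

Section SubfieldSubcode.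

Variables (F : finFieldType) (L : fieldExtType F).
Local Notation K := (finvect_type L).

Lemma mem_trace (x : K) : trace x \in (1%VS : {vspace K}).
Proof.
by apply: (mem_galTrace (K := 1%AS) (E := {:K}%AS));
  rewrite ?memvf ?finField_galois ?sub1v.
Qed.

Lemma traceD : {morph @trace F L : x y / x + y}.
Proof. by move=> x y; rewrite /trace raddfD. Qed.

Lemma traceZ (a : F) (x : K) : trace (a *: x) = a *: trace x.
Proof.
by rewrite /trace /galTrace scaler_sumr; apply: eq_bigr => s _; rewrite linearZ.
Qed.

Lemma trace_nondegenerate (x : K) : (forall y : K, trace (y * x) = 0) -> x = 0.
Proof.
move=> tr0; apply/eqP; apply/idPn => nz_x.
(* By independence of the automorphisms, their sum with all coefficients 1, which is the trace, is
   not identically zero. If it is nonzero at [y], then [y / x] contradicts [tr0]. *)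
have [||y _] := @gal_independent_contra _ _ {:K}%VS
  [in 'Gal({:K} / 1)%g] (fun=> 1) 1%g; rewrite ?oner_eq0 ?group1 //.
under eq_bigr do rewrite mul1r.
by have := tr0 (y / x); rewrite divfK // /trace /galTrace => ->; rewrite eqxx.
Qed.

Variables (n : nat) (D : {vspace 'rV[K]_n}).

(* The codewords with entries in [F] contain the orthogonal complement of the
   trace code of the dual (the nontrivial half of Delsarte's theorem), which has
   full projection on any set of fewer columns than its minimum distance. *)
Lemma subfield_subcode_interpolation (T : {set 'I_n}) (e : 'rV[F]_n) :
    (#|T| <= (min_dist (trace_code (dual_code D))).-1)%N ->
  exists2 x, x \in subfield_subcode D & forall j, j \in T -> x 0 j = (e 0 j)%:A.
Proof.
move=> leT; have {leT} ltT : (#|T| < min_dist (trace_code (dual_code D)))%N.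
  by rewrite -(prednK (min_dist_gt0 _)) ltnS.
(* [tr] is the trace with values in [F] itself, so that linear algebra over [F] applies. *)
have /fin_all_exists[tr trE] (x : K) : exists a : F, trace x = a%:A.
  by apply/vlineP; apply: mem_trace.
have inA (a b : F) : a%:A = b%:A :> K -> a = b by apply: (fmorph_inj (in_alg K)).
have trD : {morph tr : x y / x + y}.
  by move=> x y; apply: inA; rewrite scalerDl -!trE traceD.
have trZ a x : tr (a *: x) = a * tr x.
  by apply: inA; rewrite -scalerA -!trE traceZ.
have tr0 : tr 0 = 0 by rewrite -[0](scale0r (0 : K)) trZ mul0r.
(* All traces of dual codewords are rows of [B]; as they are closed under [F]-linear combinations,
   the row space of [B] is the trace code read over [F]. *)
pose B := \matrix_(i < #|dual_code D|) map_mx tr (enum_val i).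
have mem_traces (w : 'rV[F]_n) :
    (w <= B)%MS -> exists2 y, y \in dual_code D & w = map_mx tr y.
  case/submxP=> c ->; rewrite mulmx_sum_row.
  elim/big_ind: _ => [|_ _ [y yD ->] [z zD ->] | i _].
  - by exists 0; [apply: dual_code0 | apply/rowP => j; rewrite !mxE tr0].
  - by exists (y + z); [apply: dual_codeD | apply/rowP => j; rewrite !mxE trD].
  exists ((c 0 i)%:A *: enum_val i); first by rewrite dual_codeZ ?enum_valP.
  by apply/rowP => j; rewrite rowK !mxE mulr_algl trZ.
have [_ /mem_traces[y yD ->] T0|w wB we] := @interpolate_kernel F _ n B T e.
  have ty0 : map_mx (@trace F L) y = 0.
    apply: (zero_of_small_support _ (imset_f _ yD) ltT).
      apply/imsetP; exists 0; first exact: dual_code0.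
      by apply/rowP => j; rewrite !mxE trE tr0 scale0r.
    by move=> j /T0; rewrite !mxE trE => ->; rewrite scale0r.
  apply/rowP => j; apply: inA; have /rowP/(_ j) := ty0.
  by rewrite !mxE trE scale0r.
exists (map_mx (in_alg K) w); last by move=> j jT; rewrite mxE we.
rewrite inE; apply/andP; split; last first.
  by apply/forallP => j; rewrite mxE; apply/vlineP; exists (w 0 j).
(* Orthogonality to [y] is tested by the traces of all multiples by [l]. As [w] has entries in [F],
   such a trace is the product of [w] with the trace of [l *: y], which is a row of [B]. *)
apply: dual_codeK => y yD; apply/matrixP => i0 j0; rewrite !ord1 [RHS]mxE.
apply: trace_nondegenerate => l; rewrite trE.
have lyD : l *: y \in dual_code D by apply: dual_codeZ.
have /rowP/(_ (enum_rank_in lyD (l *: y))) := wB.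
rewrite mxE [RHS]mxE => wl0.
rewrite -[RHS](scale0r (1 : K)); congr (_ *: _).
have tr_sum (G : 'I_n -> K) : tr (\sum_j G j) = \sum_j tr (G j) by apply: big_morph.
rewrite !mxE mulr_sumr tr_sum -[RHS]wl0; apply: eq_bigr => j _.
by rewrite !mxE enum_rankK_in // mulr_algl -scalerAr trZ mxE.
Qed.

End SubfieldSubcode.

Theorem mainTheorem1 (F : finFieldType) (L : fieldExtType F) (n : nat)
    (C D : {vspace 'rV[finvect_type L]_n})
    (hS : pir_admissible C (codewords D)) :
  let E := subfield_subcode D in
  [/\ [/\ pir_admissible C E,
          pir_low_complexity C E,
          pir_recovers_symbols C E,
          forall rho : 'S_n, pir_arrangement C E rho -> pir_recovers_file C E rho
        & pir_arrangeable C E -> exists rho : 'S_n, pir_arrangement C E rho],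
      pir_rate C (codewords D) <= pir_rate C E
    & pir_protects C E (min_dist (trace_code (dual_code D))).-1].
Proof.
move=> E.
have le_c : (pir_c C (codewords D) <= pir_c C E)%N.
  have sED : E \subset codewords D by apply/subsetP => x; rewrite !inE => /andP[].
  rewrite /pir_c -!subn1 leq_sub2r // min_distS //; apply/subsetP => x; rewrite !inE.
  exact: (subvP (starS C sED)).
(* The divisors in b and s stay nonzero because c can only grow. *)
have adm : pir_admissible C E.
  by case/andP: hS => k_gt0 /leq_trans c_gt0; rewrite /pir_admissible k_gt0 c_gt0.
split; [split=> // | | ].
- move=> rho mu i d u j r; rewrite inE => /'forall_forallP/(_ u r).
  rewrite inE => /andP[_ /forallP/(_ j)]; rewrite !mxE summxE => dK.
  apply: memvD => //; apply: memv_suml => a _; rewrite mxE.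
  by case: andP; rewrite ?mem1v ?mem0v.
- exact: pir_scheme_recovers_symbols.
- by move=> rho; apply: pir_scheme_recovers_file.
- exact: exists_pir_arrangement.
- by rewrite !pir_rateE // ler_wpM2r ?invr_ge0 ?ler0n // ler_nat.
apply: pir_protects_interpolation => [x y | T e leT].
  rewrite !inE => /andP[xD /forallP xF] /andP[yD /forallP yF].
  by rewrite memvD //; apply/forallP => j; rewrite mxE memvD.
(* The integer targets are mapped into [F], where the interpolation takes place. *)
have [x xE xT] := subfield_subcode_interpolation (map_mx intr e) leT.
by exists x => // j jT; rewrite xT // mxE scaler_int.
Qed.
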